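(* Let $p,q,r\in\mathbb{Z}$. The upper-triangular matrix $T=\begin{pmatrix}p&r\\0&q\end{pmatrix}\in UT_2(\mathbb{Z})$ can be represented as a difference of two squares in $UT_2(\mathbb{Z})$ if and only if there exist integers $a,x,d,u$ such that $$p=a^2-x^2,\qquad q=d^2-u^2,$$ and either $$(a+d,\,x+u)\neq(0,0)\quad\text{and}\quad \gcd(a+d,\,x+u)\mid r,$$ or $$a+d=0,\quad x+u=0,\quad r=0.$$
   Context: $UT_2(\mathbb{Z})$ denotes the ring of upper-triangular $2\times 2$ matrices $\begin{pmatrix}a&b\\0&c\end{pmatrix}$ with $a,b,c\in\mathbb{Z}$, under the usual matrix addition and multiplication. A matrix $T\in UT_2(\mathbb{Z})$ is representable as a difference of two squares in $UT_2(\mathbb{Z})$ if there exist $A,B\in UT_2(\mathbb{Z})$ with $T=A^2-B^2$. *)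

(* Defs.v *)
From HB Require Import structures.
From mathcomp Require Import all_boot all_order all_algebra.
Set Implicit Arguments.
Unset Strict Implicit.
Unset Printing Implicit Defensive.
Import GRing.Theory.
Local Open Scope ring_scope.

(* [is_trig_mx] is lower triangularity, hence the transpose. *)
Definition UT2 : {pred 'M[int]_2} := [pred A | is_trig_mx A^T].

Lemma UT2E (A : 'M[int]_2) : (A \in UT2) = (A 1 0 == 0).
Proof.
rewrite inE; apply/is_trig_mxP/eqP => [trA|A10 i j lt_ij].
  by have := trA 0 1 isT; rewrite mxE.
rewrite mxE; suff [-> ->] : i = 0 /\ j = 1 by [].
by case: i j lt_ij => [[|[|//]] ?] [[|[|//]] ?] //= _; split; apply: val_inj.
Qed.

Lemma UT2_subring_closed : subring_closed UT2.
Proof.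
split=> [|A B|A B]; first by rewrite UT2E mxE.
  by rewrite !UT2E !mxE => /eqP-> /eqP->; rewrite subr0.
rewrite !UT2E mxE !big_ord_recl big_ord0 => /eqP A10 /eqP B10.
have -> : lift ord0 ord0 = 1 :> 'I_2 by apply: val_inj.
by rewrite A10 B10 mul0r mulr0 !addr0.
Qed.
HB.instance Definition _ :=
  GRing.isSubringClosed.Build 'M[int]_2 UT2 UT2_subring_closed.

(* The matrix with first row (p, r) and second row (0, q). *)
Definition ut2_mx (p r q : int) : 'M[int]_2 :=
  \matrix_(i < 2, j < 2) nth 0 (nth [::] [:: [:: p; r]; [:: 0; q]] i) j.

Lemma ut2_mx_UT2 (p r q : int) : ut2_mx p r q \in UT2.
Proof. by rewrite UT2E mxE. Qed.

Definition diff_of_squares_UT2 (T : 'M[int]_2) : Prop :=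
  exists A B : 'M[int]_2,
    [/\ A \in UT2, B \in UT2 & T = A ^+ 2 - B ^+ 2].

(* Main.v *)
Require Import Defs.
From mathcomp Require Import all_boot all_order all_algebra.
From mathcomp Require Import ring.
Import GRing.Theory.
Local Open Scope ring_scope.

(** Squaring the upper-triangular matrix with diagonal (a, d) and corner b
    squares the diagonal and multiplies the corner by the trace a + d.  Hence
    a difference of two squares with diagonals (a, d) and (x, u) has diagonal
    (a^2 - x^2, d^2 - u^2) and corner b (a + d) - y (x + u)
    ([ut2_mx_sqrB]), where the corners b and y are arbitrary integers.  By
    Bezout, the corners so obtained are exactly the multiples of
    gcd(a + d, x + u) ([dvdz_gcdP]).  The two alternatives of the theorem
    together say just that this gcd divides r: the second one is the
    degenerate case gcd(0, 0) = 0, whose only multiple is 0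
    ([dvdz_gcd_casesP]). *)

Lemma UT2_ut2_mx (A : 'M[int]_2) :
  A \in UT2 -> A = ut2_mx (A 0 0) (A 0 1) (A 1 1).
Proof.
rewrite UT2E => /eqP A10; apply/matrixP => i j; rewrite mxE.
case: i j => [[|[|//]] lti] [[|[|//]] ltj] /=; try congr (A _ _);
  try exact: val_inj.
by rewrite -A10; congr (A _ _); apply: val_inj.
Qed.

Lemma ut2_mx_inj (p r q p' r' q' : int) :
  ut2_mx p r q = ut2_mx p' r' q' -> [/\ p = p', r = r' & q = q'].
Proof.
move=> /matrixP eqT.
by split; [have := eqT 0 0 | have := eqT 0 1 | have := eqT 1 1]; rewrite !mxE.
Qed.

Lemma ut2_mx_sqrB (a b d x y u : int) :
  ut2_mx a b d ^+ 2 - ut2_mx x y u ^+ 2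
  = ut2_mx (a ^+ 2 - x ^+ 2) (b * (a + d) - y * (x + u)) (d ^+ 2 - u ^+ 2).
Proof.
apply/matrixP => i j; rewrite !expr2 !mxE !big_ord_recl !big_ord0 !mxE.
by case: i j => [[|[|//]] lti] [[|[|//]] ltj] /=; ring.
Qed.

(** Bezout's identity, with the sign that a difference of squares produces. *)
Lemma dvdz_gcdP (m n r : int) :
  (gcdz m n %| r)%Z <-> exists b y : int, r = b * m - y * n.
Proof.
split=> [/dvdzP[k ->] | [b [y ->]]].
  have [v [w <-]] := Bezoutz m n.
  by exists (k * v), (- (k * w)); ring.
by rewrite rpredB ?dvdz_mull ?dvdz_gcdl ?dvdz_gcdr.
Qed.

Lemma dvdz_gcd_casesP (m n r : int) :
  ((m, n) <> (0, 0) /\ (gcdz m n %| r)%Z) \/ [/\ m = 0, n = 0 & r = 0]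
  <-> (gcdz m n %| r)%Z.
Proof.
split=> [[[] // | [-> -> ->]] | dvd_r]; first exact: dvdz0.
have [[m0 n0] | /eqP nz] := eqVneq (m, n) (0, 0); last by left.
by right; split=> //; apply/eqP; move: dvd_r; rewrite m0 n0 gcd0z dvd0z.
Qed.

Theorem theorem1 (p q r : int) :
  diff_of_squares_UT2 (ut2_mx p r q) <->
  exists a x d u : int,
    [/\ p = a ^+ 2 - x ^+ 2,
        q = d ^+ 2 - u ^+ 2 &
        ((a + d, x + u) <> (0, 0) /\ (gcdz (a + d) (x + u) %| r)%Z) \/
        [/\ a + d = 0, x + u = 0 & r = 0]].
Proof.
split=> [[A [B [/UT2_ut2_mx-> /UT2_ut2_mx->]]] |].
  rewrite ut2_mx_sqrB => /ut2_mx_inj[-> -> ->].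
  exists (A 0 0), (B 0 0), (A 1 1), (B 1 1); split=> //.
  by apply/dvdz_gcd_casesP/dvdz_gcdP; exists (A 0 1), (B 0 1).
move=> [a [x [d [u [-> -> /dvdz_gcd_casesP/dvdz_gcdP[b [y ->]]]]]]].
exists (ut2_mx a b d), (ut2_mx x y u).
by rewrite ut2_mx_sqrB; split=> //; apply: ut2_mx_UT2.
Qed.
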